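(* Let $G$ be a tangle and let $p\in G$. Let $A\in NC^{*}(G)$ with $p\notin A$. Then there exists a continuous map $\alpha:[0,1]\to NC^{*}(G)$ such that $\alpha(0)=A$, $\alpha(1)=G$, and $p\notin B$ for every $B\in \alpha([0,1])\setminus\{G\}$.
   Context: A continuum is a compact connected metric space with more than one point. A subcontinuum of $X$ is a nonempty closed connected subset of $X$ (one-point sets are allowed). $C(X)$ denotes the hyperspace of all subcontinua of $X$, endowed with the Hausdorff metric. $NC^{*}(X)=\{A\in C(X): X\setminus A \text{ is connected}\}$, with the subspace topology from $C(X)$. The empty set counts as connected, so $X\in NC^{*}(X)$. A finite graph is a continuum that can be written as a finite union of arcs any two of which have finite intersection. A cut-point of a finite graph $G$ is a point $p\in G$ such that $G\setminus\{p\}$ is not connected. A tangle is a finite graph without cut-points (for example, a simple closed curve). *)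

(* Defs.v *)
From HB Require Import structures.
From mathcomp Require Import all_boot all_order all_algebra.
From mathcomp Require Import all_classical all_reals all_analysis.
Set Implicit Arguments. Unset Strict Implicit. Unset Printing Implicit Defensive.
Import Order.TTheory GRing.Theory Num.Theory.
Import numFieldNormedType.Exports.
Local Open Scope classical_set_scope.
Local Open Scope ring_scope.

Definition unit_interval (R : realType) : set R := [set t : R | 0 <= t <= 1].
Arguments unit_interval R : clear implicits.

Definition is_continuum (R : realType) (X : metricType R) (G : set X) : Prop :=
  compact G /\ connected G /\ exists x y, G x /\ G y /\ x <> y.

(* An arc: a homeomorphic image of [0,1] (a continuous injective image of [0,1],
   which is a homeomorphism onto its image since [0,1] is compact and X Hausdorff). *)
Definition is_arc (R : realType) (X : metricType R) (A : set X) : Prop :=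
  exists f : R -> X,
    {within unit_interval R, continuous f} /\
    set_inj (unit_interval R) f /\
    A = f @` unit_interval R.

Definition finite_graph (R : realType) (X : metricType R) (G : set X) : Prop :=
  is_continuum G /\
  exists (n : nat) (a : nat -> set X),
    (forall i, (i < n)%N -> is_arc (a i)) /\
    G = \bigcup_(i in [set i : nat | (i < n)%N]) a i /\
    (forall i j, (i < n)%N -> (j < n)%N -> i <> j -> finite_set (a i `&` a j)).

Definition tangle (R : realType) (X : metricType R) (G : set X) : Prop :=
  finite_graph G /\ forall p, G p -> connected (G `\ p).

(* Subcontinuum of G: a nonempty closed connected subset of G
   (one-point sets allowed). *)
Definition subcontinuum (R : realType) (X : metricType R) (G A : set X) : Prop :=
  A `<=` G /\ A !=set0 /\ closed A /\ connected A.

(* NC^*(G) = { A in C(G) : G \ A is connected } (the empty set is connected). *)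
Definition NCstar (R : realType) (X : metricType R) (G A : set X) : Prop :=
  subcontinuum G A /\ connected (G `\` A).

Definition hausdorff_close (R : realType) (X : metricType R) (eps : R) (A B : set X) : Prop :=
  (forall x, A x -> exists2 y, B y & mdist x y < eps) /\
  (forall y, B y -> exists2 x, A x & mdist x y < eps).

Definition hausdorff_continuous01 (R : realType) (X : metricType R) (alpha : R -> set X) : Prop :=
  forall t, unit_interval R t ->
  forall eps : R, 0 < eps -> exists2 delta : R, 0 < delta &
    forall s, unit_interval R s -> `|s - t| < delta ->
      hausdorff_close eps (alpha s) (alpha t).

(* Main.v *)
Require Import Defs.
From HB Require Import structures.
From mathcomp Require Import all_boot all_order all_algebra.
Set Implicit Arguments. Unset Strict Implicit. Unset Printing Implicit Defensive.

(* G is subdivided into a finite graph in which p is a vertex and A is a union of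
   vertices and edges; connectedness of G \ A is what makes A meet each edge in an
   interval, so that finitely many points suffice. Contracting A to a source s
   leaves a graph without cut-points, which therefore has an st-numbering with
   sink p: every vertex other than s has a neighbour with a smaller number and
   every vertex other than p one with a larger number. Extend the numbering
   linearly to the edges and sweep: alpha t is the set of points of height at most
   t * N, where N is the height of p. Following edges downwards joins each of its
   points to A, following edges upwards joins each point of the complement to p, and
   since outside A there is no local minimum of the height, alpha is continuous. *)

(** * Connectivity and st-numberings of finite graphs *)

Section StOrder.
Variables (T : finType) (e : rel T).
Hypothesis e_sym : symmetric e.

(** Connectedness of the induced graph, phrased by closed subsets instead of paths so that it
    compares directly with topological connectedness; the empty set qualifies. *)
Definition rel_connected (D : {set T}) : Prop :=
  forall W : {set T}, W \subset D -> W != set0 ->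
    (forall x y, x \in W -> y \in D -> e x y -> y \in W) -> W = D.

Lemma rel_connected_exit (D W : {set T}) :
  rel_connected D -> W \subset D -> W != set0 -> W != D ->
  exists x y, [/\ x \in W, y \in D, e x y & y \notin W].
Proof.
move=> cD WD W0 WnD.
have [/existsP[x /existsP[y /and4P[? ? ? ?]]]|] :=
  boolP [exists x, exists y, [&& x \in W, y \in D, e x y & y \notin W]].
  by exists x, y.
rewrite negb_exists => /forallP nex; case/eqP: WnD; apply: cD => // x y xW yD exy.
have := nex x; rewrite negb_exists => /forallP/(_ y).
by rewrite xW yD exy /= negbK.
Qed.

(** The component of [p] in the graph induced on [D]; it contains [p] even when [D] does not. *)
Let reach (D : {set T}) p : {set T} :=
  [set x | connect [rel x y | [&& e x y, x \in D & y \in D]] p x].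

Let reach_refl (D : {set T}) p : p \in reach D p.
Proof. by rewrite inE connect0. Qed.

Let reach_step (D : {set T}) p x y :
  x \in reach D p -> x \in D -> y \in D -> e x y -> y \in reach D p.
Proof.
rewrite !inE => px xD yD exy; apply: connect_trans px (connect1 _) => /=.
by rewrite exy xD yD.
Qed.

Let reach_min (D W : {set T}) p : p \in W ->
  (forall x y, x \in W -> x \in D -> y \in D -> e x y -> y \in W) ->
  reach D p \subset W.
Proof.
move=> pW clW; apply/subsetP => x; rewrite inE => /connectP[s sP ->].
elim: s p pW sP => [//|y s IHs] p pW /= /andP[/and3P[epy pD yD] sP].
by apply: IHs => //; apply: clW pW pD yD epy.
Qed.

Let reach_sub (D : {set T}) p : p \in D -> reach D p \subset D.
Proof. by move=> pD; apply: reach_min. Qed.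

Let reach_connected (D : {set T}) p : p \in D -> reach D p = D -> rel_connected D.
Proof.
move=> pD DE W WD /set0Pn[x xW] clW.
(* If [p] were outside [W], then by symmetry of [e] the complement of [W] would also be closed under
   steps in [D], and would contain the component of [p], which is all of [D]. *)
have pW : p \in W.
  apply: contraT => pW.
  have /subsetP/(_ x) : reach D p \subset ~: W.
    apply: reach_min; first by rewrite inE.
    move=> y z; rewrite !inE => yW yD zD eyz; apply: contra yW => zW.
    by apply: clW zW yD _; rewrite e_sym.
  by rewrite DE inE (subsetP WD _ xW) xW => /(_ isT).
apply/eqP; rewrite eqEsubset WD /= -{1}DE; apply: reach_min => // y z yW _ zD.
exact: clW yW zD.
Qed.

(* Among the neighbours v <> p of S, one maximising the component of p in D \ v
   does not disconnect D: another component would contain a neighbour w of S,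
   and D \ w would have a larger component at p. *)
Lemma exists_noncut_neighbour (S : {set T}) (p : T) :
  (forall v, rel_connected (~: [set v])) -> rel_connected (~: S) ->
  p \notin S -> S != set0 -> ~: S != [set p] ->
  exists v, [/\ v \notin S, v != p, exists2 s, s \in S & e v s
              & rel_connected (~: (v |: S))].
Proof.
move=> c2 cS pS S0 Snp.
pose P v := [&& v \notin S, v != p & [exists s in S, e v s]].
(* The graph without [p] is connected and [S] is not all of it, so some edge leaves [S] towards a
   vertex other than [p]. *)
have [v0 Pv0] : exists v, P v.
  have Sp : S \subset ~: [set p].
    by apply/subsetP => x xS; rewrite !inE; apply: contraNneq pS => <-.
  have Sp' : S != ~: [set p] by apply: contraNneq Snp => ->; rewrite setCK.
  have [x [y [xS]]] := rel_connected_exit (c2 p) Sp S0 Sp'.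
  rewrite !inE => yp exy yS; exists y; rewrite /P yS yp /=.
  by apply/existsP; exists x; rewrite xS e_sym exy.
case: (@arg_maxnP _ v0 P (fun v => #|reach (~: (v |: S)) p|) Pv0) => v Pv vmax.
case/and3P: (Pv) => vS vp /existsP[s /andP[sS evs]].
exists v; split => //; first by exists s.
set D := ~: (v |: S) in vmax *.
have pD : p \in D by rewrite !inE negb_or eq_sym vp pS.
have RD := reach_sub pD.
apply: (reach_connected pD); apply/eqP; apply: contraT => RnD.
have [z zD zR] : exists2 z, z \in D & z \notin reach D p.
  by apply/subsetPn; apply: contra RnD => DR; rewrite eqEsubset RD.
have Rcl x y : x \in reach D p -> y \in D -> e x y -> y \in reach D p.
  by move=> xR; apply: reach_step => //; apply: (subsetP RD).
pose C := D :\: reach D p.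
have Cv : C \subset ~: [set v].
  by apply/subsetP => x; rewrite !inE negb_or => /andP[_ /andP[]].
have C0 : C != set0 by apply/set0Pn; exists z; rewrite in_setD zR zD.
have pR : p \in reach D p := reach_refl D p.
have Cnv : C != ~: [set v].
  apply: contraTneq pR => /setP/(_ p).
  by rewrite in_setD pD andbT !inE eq_sym vp => ->.
(* An edge leaving [C] and avoiding [v] cannot reach the component of [p], so it ends in [S]; hence
   [w] is itself a candidate. *)
have [w [y [wC yv ewy yC]]] := rel_connected_exit (c2 v) Cv C0 Cnv.
case/setDP: (wC) => wD wR.
have yS : y \in S.
  apply: contraT => yS.
  have yD : y \in D by rewrite !inE negb_or yS andbT; move: yv; rewrite !inE.
  move: yC; rewrite in_setD yD andbT negbK => yR.
  by case/negP: wR; apply: Rcl yR wD _; rewrite e_sym.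
have Pw : P w.
  apply/and3P; split.
  - by move: wD; rewrite !inE negb_or => /andP[].
  - by apply: contraNneq wR => ->.
  - by apply/existsP; exists y; rewrite yS.
have wv : w != v by move: wD; rewrite !inE negb_or => /andP[].
pose Dw := ~: (w |: S).
have inDw x : x \in Dw = (x != w) && (x \notin S) by rewrite !inE negb_or.
have RDw x : x \in reach D p -> x \in Dw.
  move=> xR; rewrite inDw; apply/andP; split; first by apply: contraNneq wR => <-.
  by have := subsetP RD _ xR; rewrite !inE negb_or => /andP[].
have RR : reach D p \subset reach Dw p.
  rewrite -(setIid (reach D p)).
  have /subset_trans : reach D p \subset reach D p :&: reach Dw p.
    apply: reach_min; first by rewrite inE !reach_refl.
    move=> a b /setIP[aR aRw] aD bD eab; rewrite inE (Rcl a b) //=.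
    by apply: (reach_step aRw) => //; apply: RDw => //; apply: Rcl eab.
  by rewrite setIid; apply; apply: subsetIr.
have vRw : v \in reach Dw p.
  have RS : reach D p \subset ~: S.
    by apply: (subset_trans RD); rewrite setCS subsetUr.
  have R0 : reach D p != set0 by apply/set0Pn; exists p.
  have RnS : reach D p != ~: S.
    apply/eqP => E; have : v \in reach D p by rewrite E inE vS.
    by move/(subsetP RD); rewrite !inE eqxx.
  (* Inside the complement of [S] the component of [p] in [D] can only be left through [v], which is
     available again in [Dw]. *)
  have [a [b [aR bS eab bR]]] := rel_connected_exit cS RS R0 RnS.
  have bv : b = v.
    apply: contraNeq bR => bv; apply: Rcl eab => //.
    by rewrite !inE negb_or bv; rewrite inE in bS.
  rewrite -bv; apply: reach_step (subsetP RR _ aR) _ _ eab; first exact: RDw.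
  by rewrite inDw bv eq_sym wv.
have /= := vmax w Pw; rewrite leqNgt => /negP[]; apply: proper_card.
apply/properP; split => //; exists v => //.
by apply/negP => /(subsetP RD); rewrite !inE eqxx.
Qed.

(* The Lempel-Even-Cederbaum st-numbering, with the whole of S as source. *)
Lemma exists_st_order (S : {set T}) (p : T) :
  rel_connected [set: T] ->
  (forall v, rel_connected (~: [set v])) -> rel_connected (~: S) ->
  p \notin S -> S != set0 ->
  exists r : T -> nat, [/\ forall x, (r x == 0) = (x \in S),
    forall x, x \notin S -> exists2 y, e x y & r y < r x,
    forall x, x \notin S -> x != p -> exists2 y, e x y & r x < r y,
    forall x, x != p -> r x < r p
    & forall x y, r x = r y -> x \in S \/ x = y].
Proof.
move=> c1 c2; have [n] := ubnP #|~: S|; elim: n S => // n IHn S leSn cS pS S0.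
have [Sp|Snp] := eqVneq (~: S) [set p].
  have inS x : (x \in S) = (x != p) by rewrite -[S]setCK Sp !inE.
  exists (fun x => x == p : nat); split => [x|x|x|x|x y].
  - by rewrite inS; case: (x == p).
  - rewrite inS negbK => /eqP ->.
    have [a [b [aW _ eab bW]]] : exists x y,
        [/\ x \in [set p], y \in [set: T], e x y & y \notin [set p]].
      apply: rel_connected_exit => //; first by apply/set0Pn; exists p; rewrite inE.
      rewrite -Sp; apply: contraNneq S0 => /setP E; apply/eqP/setP => z.
      by have := E z; rewrite !inE => /negbTE.
    move: aW bW; rewrite !inE => /eqP <- bp; exists b; rewrite // eqxx.
    by rewrite (negbTE bp).
  - by rewrite inS negbK => ->.
  - by rewrite eqxx => /negbTE ->.
  - rewrite inS; have [->|] := eqVneq x p; last by left.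
    by have [->|] := eqVneq y p; [right|].
have [v [vS vp [s sS evs] cD]] := exists_noncut_neighbour c2 cS pS S0 Snp.
(* Absorb a noncut neighbour [v] into the source and number the rest by induction. *)
have [||||r [r0 rlow rhigh rp rinj]] := IHn (v |: S).
- rewrite -ltnS; apply: leq_trans leSn; rewrite ltnS; apply: proper_card.
  apply/properP; split; first by rewrite setCS subsetUr.
  by exists v; rewrite !inE ?eqxx.
- exact: cD.
- by rewrite !inE negb_or eq_sym vp.
- by apply/set0Pn; exists v; rewrite !inE eqxx.
have in_vS x : (x \in v |: S) = (x == v) || (x \in S) by rewrite !inE.
have rv : r v = 0 by apply/eqP; rewrite r0 in_vS eqxx.
(* The old numbers move up by one and [S] keeps 0, so [v], formerly in the source, becomes the only
   vertex numbered 1. *)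
exists (fun x => if x \in S then 0 else (r x).+1); split => [x|x xS|x xS xp|x xp|x y].
- by case: ifP.
- rewrite (negbTE xS); have [->|xv] := eqVneq x v; first by exists s; rewrite ?sS.
  have [|y exy ryx] := rlow x; first by rewrite in_vS negb_or xv.
  by exists y => //; case: ifP.
- rewrite (negbTE xS); have [->|xv] := eqVneq x v; last first.
    have [|//|y exy rxy] := rhigh x; first by rewrite in_vS negb_or xv.
    exists y => //; case: ifP => // yS.
    by have := r0 y; rewrite in_vS yS orbT; case: (r y) rxy.
  (* The higher neighbour of [v] comes from connectedness of the complement of [S]: any neighbour of
     [v] there has a number above 1. *)
  have [||||a [b [/set1P -> bS evb bv]]] := @rel_connected_exit (~: S) [set v].
  + exact: cS.
  + by rewrite sub1set inE.
  + by apply/set0Pn; exists v; rewrite inE.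
  + apply: contraNneq vp => /setP/(_ p); rewrite !inE (negbTE pS) => /eqP ->.
    by rewrite eqxx.
  exists b => //; rewrite inE in bS; rewrite (negbTE bS) rv ltnS lt0n r0 in_vS.
  by rewrite negb_or bS andbT; rewrite inE in bv.
- by rewrite (negbTE pS); case: ifP => // _; rewrite ltnS rp.
- case: ifP => [|xS]; first by left.
  case: ifP => // yS [rxy]; right.
  have [|//] := rinj _ _ rxy; rewrite in_vS xS orbF => /eqP xv.
  by move: rxy; rewrite xv rv => /esym/eqP; rewrite r0 in_vS yS orbF => /eqP.
Qed.

End StOrder.

From mathcomp Require Import all_classical all_reals all_analysis.
From mathcomp Require Import lra.
Import Order.TTheory GRing.Theory Num.Theory.
Import numFieldNormedType.Exports.
Local Open Scope classical_set_scope.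
Local Open Scope ring_scope.

(** * Tools on connectedness and finite minima *)

Lemma connected_closed_cover (T : topologicalType) (D C1 C2 : set T) :
  connected D -> closed C1 -> closed C2 -> D `<=` C1 `|` C2 ->
  (forall x, D x -> C1 x -> C2 x -> False) -> D `<=` C1 \/ D `<=` C2.
Proof.
move=> cD cC1 cC2 DC disj.
have [[x [Dx C1x]]|D1] := pselect (exists x, D x /\ C1 x); last first.
  by right=> x Dx; have [C1x|//] := DC _ Dx; case: D1; exists x.
left; suff <- : D `&` C1 = D by move=> y [].
apply: cD; [by exists x| |by exists C1].
exists (~` C2); first exact: closed_openC.
apply/seteqP; split=> y [Dy]; first by move=> C1y; split=> // /(disj _ Dy C1y).
by move=> C2y; split=> //; have [] := DC _ Dy.
Qed.

Lemma connected_star (T : topologicalType) (S B : set T) :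
  connected B -> B `<=` S -> B !=set0 ->
  (forall x, S x -> exists C, [/\ connected C, C x, C `&` B !=set0 & C `<=` S]) ->
  connected S.
Proof.
move=> cB BS [b Bb] star.
have /choice[C CP] : forall x, exists C, S x ->
    [/\ connected C, C x, C `&` B !=set0 & C `<=` S].
  move=> x; have [/star[C CP]|nSx] := pselect (S x); first by exists C.
  by exists set0.
have -> : S = \bigcup_(x in S) (C x `|` B).
  apply/seteqP; split=> [x Sx|y [x Sx]].
    by exists x => //; left; case: (CP _ Sx).
  by case=> [Cy|/BS//]; case: (CP _ Sx) => _ _ _; exact.
apply: bigcup_connected; first by exists b => x Sx; right.
by move=> x /CP[cC _ CB _]; exact: connectedU.
Qed.

Lemma finite_uniform_pos (R : realType) (I : finType) (P : I -> R -> Prop) :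
  (forall i, exists2 d : R, 0 < d & P i d) ->
  (forall i d d', 0 < d' <= d -> P i d -> P i d') ->
  exists2 d : R, 0 < d & forall i, P i d.
Proof.
move=> exP monP.
have /choice[d dP] : forall i, exists d : R, 0 < d /\ P i d.
  by move=> i; have [d] := exP i; exists d.
pose m := \big[Num.min/1]_i d i; have m0 : 0 < m.
  by rewrite /m; elim/big_ind: _ => // [x y x0 y0|i _]; [rewrite lt_min x0|case: (dP i)].
exists m => // i; apply: monP (proj2 (dP i)); rewrite m0 /=.
by rewrite /m (bigminD1 i) // ge_min lexx.
Qed.

(** * Arcs and their parametrisations *)

Section Arcs.
Variables (R : realType) (X : metricType R).
Local Notation I01 := (unit_interval R).

Lemma unit_interval0 : I01 0. Proof. by rewrite /unit_interval /= lexx ler01. Qed.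
Lemma unit_interval1 : I01 1. Proof. by rewrite /unit_interval /= lexx ler01. Qed.
#[local] Hint Resolve unit_interval0 unit_interval1 : core.

Lemma unit_intervalE : I01 = `[0, 1]%classic.
Proof. by apply/seteqP; split=> t /=; rewrite in_itv. Qed.

Lemma interior_unit_interval (s : R) : 0 < s < 1 -> I01 s.
Proof. by move=> /andP[/ltW s0 /ltW s1]; rewrite /unit_interval /= s0. Qed.

Lemma unit_interval_end (s : R) : I01 s -> ~ (0 < s < 1) -> s = 0 \/ s = 1.
Proof.
rewrite /unit_interval /= => /andP[s0 s1] ns.
have [->|sn0] := eqVneq s 0; first by left.
have [->|sn1] := eqVneq s 1; first by right.
by case: ns; rewrite !lt_neqAle s0 s1 eq_sym sn0 sn1.
Qed.

Lemma continuous_affine (a b : R) : continuous (fun s : R => a + s * b).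
Proof.
move=> x; apply: cvgD; first exact: cvg_cst.
by apply: cvgM; [exact: cvg_id|exact: cvg_cst].
Qed.

Lemma continuous_comp_affine (f : R -> X) (a b : R) :
  continuous f -> continuous (fun s : R => f (a + s * b)).
Proof. by move=> cf x; apply: continuous_comp; [exact: continuous_affine|exact: cf]. Qed.

(** Precomposing with the retraction of the line onto the unit interval gives a parametrisation
    continuous everywhere, which spares subspace topologies from here on. *)
Lemma is_arc_extend (A : set X) : is_arc A -> exists f : R -> X,
  [/\ continuous f, set_inj I01 f & A = f @` I01].
Proof.
case=> f [cf [injf ->]].
pose clip (s : R) := Num.max 0 (Num.min 1 s).
have clipI s : I01 (clip s).
  by rewrite /unit_interval /clip /= le_max lexx ge_max ler01 ge_min lexx.
have clip_id s : I01 s -> clip s = s.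
  by rewrite /unit_interval /clip /= => /andP[s0 s1]; rewrite min_r // max_r.
have cclip : continuous clip.
  move=> x; have c0 : {for x, continuous (cst 0 : R -> R^o)} by exact: cst_continuous.
  have c1 : {for x, continuous (cst 1 : R -> R^o)} by exact: cst_continuous.
  have cid : {for x, continuous (id : R -> R^o)} by exact: cvg_id.
  exact: (continuous_max c0 (continuous_min c1 cid)).
exists (f \o clip); split.
- move=> x; move/subspace_continuousP: cf => /(_ _ (clipI x)) cf U /cf /= Ux.
  have : (nbhs x) (fun y => I01 (clip y) -> U (f (clip y))) by exact: cclip Ux.
  by apply: filterS => y; apply.
- move=> s t; rewrite !inE => Is It /=; rewrite !clip_id // => E.
  by apply: injf; rewrite ?inE.
- apply/seteqP; split=> _ [s Is <-]; first by exists s; rewrite //= clip_id.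
  by exists (clip s).
Qed.

Lemma closed_arc_image (f : R -> X) (K : set R) :
  continuous f -> closed K -> closed (f @` (I01 `&` K)).
Proof.
move=> cf cK; apply: (compact_closed (@metric_hausdorff _ _)).
apply: continuous_compact; first exact: continuous_subspaceT.
apply: compact_closedI => //; rewrite unit_intervalE; exact: segment_compact.
Qed.

Lemma closed_arc (f : R -> X) : continuous f -> closed (f @` I01).
Proof. by move=> cf; rewrite -[I01]setIT; exact: closed_arc_image. Qed.

Lemma connected_arc_image (f : R -> X) (K : set R) :
  continuous f -> is_interval K -> connected (f @` K).
Proof.
move=> cf iK; apply: connected_continuous_connected; last exact: continuous_subspaceT.
exact/connected_intervalP.
Qed.

(** Heine's theorem, from the near-covering form of compactness: around each point of the interval
    one bound on [eta] serves a whole neighbourhood. *)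
Lemma arc_uniform_continuity (f : R -> X) (eps : R) : continuous f -> 0 < eps ->
  exists2 eta : R, 0 < eta & forall r s, I01 r -> I01 s -> `|r - s| < eta ->
    mdist (f r) (f s) < eps.
Proof.
move=> cf e0.
have /compact_near_coveringP cI : compact I01.
  by rewrite unit_intervalE; exact: segment_compact.
have := cI R 0^'+ (fun eta x => forall s, `|x - s| < eta -> mdist (f x) (f s) < eps).
case=> [x _|eta /= eta0 H].
  have e2 : 0 < eps / 2 by rewrite divr_gt0.
  have /nbhs_ballP[d /= d0 dP] := cf x _ (nbhsx_ballx (f x) _ e2).
  have d2 : 0 < d / 2 by rewrite divr_gt0.
  exists (ball x (d / 2), [set eta : R | eta < d / 2]) => /=.
    by split; [exact: nbhsx_ballx|exact: nbhs_right_lt].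
  move=> [y eta] /= [xy etad] s ys.
  have fy : ball (f x) (eps / 2) (f y).
    by apply: dP; apply: le_ball xy; rewrite ler_pdivrMr // ler_peMr ?ltW // ltr1n.
  have fs : ball (f x) (eps / 2) (f s).
    apply: dP; rewrite [d]splitr; apply: (ball_triangle xy).
    exact: (lt_trans ys etad).
  by have := ball_splitr fy fs; rewrite ballEmdist.
exists (eta / 2); first by rewrite divr_gt0.
move=> r s Ir Is rs; apply: (H (eta / 2)) rs => //; last by rewrite divr_gt0.
by rewrite /ball /= sub0r normrN gtr0_norm ?divr_gt0 // ltr_pdivrMr // ltr_pMr // ltr1n.
Qed.

(** * Edge systems and their subdivision *)

(** A graph structure on [G] without loops; parallel edges are allowed. Taking [t] in the closed
    interval in the last clause keeps the endpoints of every edge off all edge interiors. *)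
Definition edge_system (I : finType) (f : I -> R -> X) (G : set X) : Prop :=
  [/\ forall i, continuous (f i), forall i, set_inj I01 (f i),
      G = \bigcup_i (f i @` I01) &
      forall i j (s t : R), 0 < s < 1 -> I01 t -> f i s = f j t -> i = j].

(** The greatest mark at most [r] and the least mark above [r] bracket it. Nothing lies above
    [r = 1] for certain, so there the bracket is the last one, ending at [x1]. *)
Lemma finite_consecutive (T : finType) (P : pred T) (c : T -> R) (x0 x1 : T) (r : R) :
  P x0 -> P x1 -> c x0 = 0 -> c x1 = 1 -> I01 r ->
  exists x y, [/\ P x, P y, c x < c y, c x <= r <= c y &
    forall z, P z -> ~ (c x < c z < c y)].
Proof.
move=> P0 P1 c0 c1 /andP[r0 r1]; have [r1'|r1'] := ltP r 1.
  have Q0 : P x0 && (c x0 <= r) by rewrite P0 c0.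
  have Q1 : P x1 && (r < c x1) by rewrite P1 c1.
  case: (@arg_maxP _ _ _ x0 (fun x => P x && (c x <= r)) c Q0) => x /andP[Px cx] xmax.
  case: (@arg_minP _ _ _ x1 (fun x => P x && (r < c x)) c Q1) => y /andP[Py cy] ymin.
  exists x, y; split=> //; first exact: le_lt_trans cy.
    by rewrite cx ltW.
  move=> z Pz /andP[xz zy]; have [zr|rz] := leP (c z) r.
    by have := xmax z; rewrite Pz zr => /(_ isT) /(lt_le_trans xz); rewrite ltxx.
  by have := ymin z; rewrite Pz rz => /(_ isT) /(lt_le_trans zy); rewrite ltxx.
have {r1 r1'}-> : r = 1 by apply/le_anti; rewrite r1 r1'.
have Q0 : P x0 && (c x0 < 1) by rewrite P0 c0 ltr01.
case: (@arg_maxP _ _ _ x0 (fun x => P x && (c x < 1)) c Q0) => x /andP[Px cx] xmax.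
exists x, x1; rewrite c1; split=> //; first by rewrite lexx ltW.
move=> z Pz /andP[xz z1].
by have := xmax z; rewrite Pz z1 => /(_ isT) /(lt_le_trans xz); rewrite ltxx.
Qed.

(** Cut every arc at the points of [F] on it. Since [F] holds all endpoints and all crossings of arc
    interiors, the pieces can meet only in their endpoints. *)
Lemma edge_system_subdivide (I : finType) (f : I -> R -> X) (F : seq X) :
  (forall i, continuous (f i)) -> (forall i, set_inj I01 (f i)) ->
  (forall i, f i 0 \in F /\ f i 1 \in F) ->
  (forall i j (s t : R), i <> j -> 0 < s < 1 -> 0 < t < 1 -> f i s = f j t -> f i s \in F) ->
  exists (J : finType) (g : J -> R -> X),
    edge_system g (\bigcup_i (f i @` I01)) /\
    (forall j (s : R), 0 < s < 1 -> g j s \notin F).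
Proof.
move=> cf injf fF meetF.
have {}injf i s t : I01 s -> I01 t -> f i s = f i t -> s = t.
  by move=> Is It; apply: injf; rewrite inE.
pose T := seq_sub F.
(* The parameter of [x] on arc [i], with default 0 if [x] is not on it; [on] tells the two
   situations apart. *)
pose par i (x : T) : R := xget 0 [set s | I01 s /\ f i s = val x].
have parI i x : I01 (par i x) by rewrite /par; case: xgetP => // s _ [].
pose on i (x : T) := f i (par i x) == val x.
have onP i s : I01 s -> f i s \in F -> exists2 x : T, on i x & par i x = s.
  move=> Is Fs; exists (SeqSub Fs).
    by rewrite /on /par; case: xgetP => [t _ [_ ->]|/(_ s)[]].
  rewrite /par; case: xgetP => [t _ [It /= E]|/(_ s)[]//].
  exact: injf E.
(* A new edge is an arc together with two cut points that are consecutive on it. *)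
pose consec (k : I * T * T) := let: (i, x, y) := k in
  [&& on i x, on i y, par i x < par i y &
      [forall z : T, on i z ==> ~~ (par i x < par i z < par i y)]].
pose J := {k : I * T * T | consec k}.
pose g (j : J) (s : R) : X := let: (i, x, y) := val j in
  f i (par i x + s * (par i y - par i x)).
have aff (a b s : R) : a < b -> 0 < s < 1 -> a < a + s * (b - a) < b.
  by move=> ab s01; nra.
have affI (a b s : R) : I01 a -> I01 b -> I01 s -> I01 (a + s * (b - a)).
  by rewrite /unit_interval /= => *; nra.
have openF i x y a : consec (i, x, y) -> par i x < a < par i y -> f i a \notin F.
  case/and4P=> _ _ _ /forallP no axy; apply/negP.
  have Ia : I01 a.
    by have := parI i x; have := parI i y; rewrite /unit_interval /= => *; lra.
  case/(onP _ _ Ia) => z oz za; have := no z.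
  by rewrite oz za axy.
exists J, g; split; last first.
  move=> [[[i x] y] /= c] s s01; rewrite /g /=; apply: openF (c) _; apply: aff => //.
  by case/and4P: c.
split.
- by move=> [[[i x] y] /= c]; exact: continuous_comp_affine.
- move=> [[[i x] y] /= c] s t; rewrite !inE /g /= => Is It /injf E.
  case/and4P: c => _ _ lt_xy _.
  have /eqP : (s - t) * (par i y - par i x) = 0.
    by have := E (affI _ _ _ (parI _ _) (parI _ _) Is) (affI _ _ _ (parI _ _) (parI _ _) It); lra.
  by rewrite mulf_eq0 !subr_eq0 (gt_eqF lt_xy) orbF => /eqP.
- apply/seteqP; split=> [z [i _ [r Ir <-]]|z [[[[i x] y] c] _ [s Is <-]]]; last first.
    by exists i => //; rewrite /g /=; eexists; last reflexivity; exact: affI.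
  have [F0 F1] := fF i.
  have [x0 on0 par0] : exists2 x, on i x & par i x = 0 by exact: onP.
  have [x1 on1 par1] : exists2 x, on i x & par i x = 1 by exact: onP.
  have [x [y [onx ony lt_xy xry no]]] := finite_consecutive on0 on1 par0 par1 Ir.
  have c : consec (i, x, y).
    rewrite /= onx ony lt_xy; apply/forallP => w; apply/implyP => ow.
    by apply/negP; exact: no.
  exists (exist (fun k => is_true (consec k)) (i, x, y) c) => //.
  exists ((r - par i x) / (par i y - par i x)).
    rewrite /unit_interval /= divr_ge0 ?subr_ge0 ?(ltW lt_xy) //=; last by case/andP: xry.
    by rewrite ler_pdivrMr ?subr_gt0 // mul1r lerD2r; case/andP: xry.
  by rewrite /g /= divfK ?subr_eq0 ?gt_eqF // addrC subrK.
- move=> [[[i x] y] /= c] [[[i' x'] y'] /= c'] s t s01 It; rewrite /g /=.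
  set a := _ + s * _; set b := _ + t * _ => fab.
  have lt_xy : par i x < par i y by case/and4P: c.
  have [ox' oy' lt_xy' no'] : [/\ on i' x', on i' y', par i' x' < par i' y' &
      forall z, on i' z -> ~~ (par i' x' < par i' z < par i' y')].
    by case/and4P: (c') => ? ? ? /forallP no; split=> // z oz; have := no z; rewrite oz.
  have [ox oy no] : [/\ on i x, on i y &
      forall z, on i z -> ~~ (par i x < par i z < par i y)].
    by case/and4P: (c) => ? ? ? /forallP no; split=> // z oz; have := no z; rewrite oz.
  have axy : par i x < a < par i y by exact: aff.
  have aF : f i a \notin F by exact: openF axy.
  have bxy : par i' x' < b < par i' y'.
    apply: aff => //; apply: contrapT => /(unit_interval_end It) t01.
    case/negP: aF; rewrite fab /b; case: t01 => ->.
      by rewrite mul0r addr0 (eqP ox') ssvalP.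
    by rewrite mul1r addrC subrK (eqP oy') ssvalP.
  have Ia : I01 a by apply: affI => //; exact: interior_unit_interval.
  have Ib : I01 b by exact: affI.
  have inner (u v w : R) : I01 u -> I01 v -> u < w < v -> 0 < w < 1.
    by rewrite /unit_interval /= => *; lra.
  have ii' : i = i'.
    apply: contrapT => /(meetF _ _ a b) H; case/negP: aF; apply: H => //.
      exact: inner axy.
    exact: inner bxy.
  clearbody a b; subst i'.
  have ab : a = b by exact: injf fab.
  rewrite -{b fab Ib}ab in bxy.
  have same z z' : on i z -> on i z' -> par i z = par i z' -> z = z'.
    by move=> /eqP oz /eqP oz' E; apply: val_inj; rewrite /= -oz -oz' E.
  (* Both open parameter intervals contain [a] and neither contains a cut parameter, so their ends
     agree. *)
  have {ox ox'}E1 : x = x'.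
    apply: same => //; apply/eqP; rewrite eq_le !leNgt.
    by apply/andP; split; apply/negP => lt;
      [have := no' x ox|have := no x' ox']; move/negP; apply; lra.
  have {oy oy'}E2 : y = y'.
    apply: same => //; apply/eqP; rewrite eq_le !leNgt.
    by apply/andP; split; apply/negP => lt;
      [have := no y' oy'|have := no' y oy]; move/negP; apply; lra.
  by apply: val_inj; rewrite /= E1 E2.
Qed.

Lemma closed_unit_interval_sub (K : set R) :
  closed K -> (forall s, 0 < s < 1 -> K s) -> I01 `<=` K.
Proof.
move=> clK inK t It; apply: contrapT => nKt.
have /nbhs_ballP[e /= e0 eK] : nbhs t (~` K).
  by apply: open_nbhs_nbhs; split=> //; exact: closed_openC.
have [d [d0 de d1]] : exists d : R, [/\ 0 < d, d < e & d < 1].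
  by have [e1|e1] := leP e 1; [exists (e / 2)|exists (1 / 2)]; split; lra.
have K' s : `|t - s| < e -> 0 < s < 1 -> False by move=> /eK nKs /inK.
have [t01|/(unit_interval_end It) [] t01] := pselect (0 < t < 1).
- exact/nKt/inK.
- by apply: (K' d); rewrite ?d0 // t01 sub0r normrN gtr0_norm.
- by apply: (K' (1 - d)); [rewrite t01 subKr gtr0_norm|lra].
Qed.

Lemma edge_system_meet (I : finType) (f : I -> R -> X) (G : set X) i j (s t : R) :
  edge_system f G -> I01 s -> I01 t -> f i s = f j t ->
  (i = j /\ s = t) \/ ((s = 0 \/ s = 1) /\ (t = 0 \/ t = 1)).
Proof.
move=> [_ injf _ disj] Is It E.
have [s01|/(unit_interval_end Is) s01] := pselect (0 < s < 1).
  left; have ij := disj _ _ _ _ s01 It E; split=> //; subst j.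
  by apply: injf E; rewrite inE.
have [t01|/(unit_interval_end It) t01] := pselect (0 < t < 1); last by right.
left; have ij := disj _ _ _ _ t01 Is (esym E); split=> //; subst j.
by apply: injf E; rewrite inE.
Qed.

Lemma edge_system_closed (I : finType) (f : I -> R -> X) (G : set X) (P : set I) :
  edge_system f G -> closed (\bigcup_(i in P) (f i @` I01)).
Proof.
move=> [cf _ _ _]; apply: closed_bigcup; [exact: finite_finset|move=> i _]; exact: closed_arc.
Qed.

(** Cut at [p], at the endpoints of the arcs and at their pairwise intersections, which are finitely
    many points altogether. *)
Lemma finite_graph_edges (G : set X) (p : X) : finite_graph G ->
  exists (I : finType) (f : I -> R -> X),
    edge_system f G /\ (forall i (s : R), 0 < s < 1 -> f i s <> p).
Proof.
move=> [_ [n [a [arca [-> fin]]]]].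
have /choice[f fP] : forall i : 'I_n, exists f : R -> X,
    [/\ continuous f, set_inj I01 f & a i = f @` I01].
  by move=> i; apply: is_arc_extend; exact: arca.
have -> : \bigcup_(i in [set i : nat | (i < n)%N]) a i =
    \bigcup_(i : 'I_n) (f i @` I01).
  apply/seteqP; split=> [x [i /= ilt ax]|x [i _ fx]].
    by exists (Ordinal ilt) => //; case: (fP (Ordinal ilt)) => _ _ <-.
  by exists i => /=; [exact: ltn_ord|case: (fP i) => _ _ ->].
pose F := [set p] `|` \bigcup_(i : 'I_n) [set f i 0; f i 1] `|`
  \bigcup_(ij in [set ij : 'I_n * 'I_n | ij.1 <> ij.2]) (a ij.1 `&` a ij.2).
have /finite_seqP[Fs FE] : finite_set F.
  rewrite !finite_setU; split; first split.
  - exact: finite_set1.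
  - by apply: bigcup_finite => [|i _]; [exact: finite_finset|exact: finite_set2].
  - apply: bigcup_finite => [|[i j] /= ij]; first exact: finite_finset.
     apply: fin; rewrite ?ltn_ord //.
    by move=> /val_inj.
have FsE x : F x -> x \in Fs by rewrite FE.
have [||||J [g [gS gF]]] := edge_system_subdivide (f := f) (F := Fs).
- by move=> i; case: (fP i).
- by move=> i; case: (fP i).
- by move=> i; split; apply: FsE; left; right; exists i => //=; [left|right].
- move=> i j s t ij s01 t01 E; apply: FsE; right; exists (i, j) => //=; split.
    by case: (fP i) => _ _ ->; exists s => //; exact: interior_unit_interval.
  by case: (fP j) => _ _ ->; exists t => //; exact: interior_unit_interval.
exists J, g; split=> // j s s01 E; case/negP: (gF j s s01).
by rewrite E; apply: FsE; left; left.
Qed.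

(** * Subdivision adapted to the subcontinuum [A] *)

Section AdaptedSubdivision.
Variables (I : finType) (f : I -> R -> X) (G A : set X) (p : X).
Hypotheses (fG : edge_system f G) (Gp : G p) (nAp : ~ A p).
Hypothesis p_vertex : forall i (s : R), 0 < s < 1 -> f i s <> p.
Hypotheses (clA : closed A) (cGA : connected (G `\` A)).

(** The segment from [f i a] to [f i b] and the rest of [G] meet only in these two points of [A], so
    the connected set of points off [A] lies on one side. The vertex [p] is off [A] and not in the
    segment, so the segment contains no point off [A]. *)
Lemma edge_preimage_convex i (a b c : R) : I01 a -> I01 b -> a <= c <= b ->
  A (f i a) -> A (f i b) -> A (f i c).
Proof.
move=> Ia Ib acb Aa Ab; apply: contrapT => nAc.
have Ic : I01 c by move: Ia Ib; rewrite /unit_interval /= => *; lra.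
have [cf injf GE _] := fG.
pose C1 := f i @` (I01 `&` `[a, b]).
pose C2 := \bigcup_(j in [set j | j <> i]) (f j @` I01) `|`
  f i @` (I01 `&` ([set s | s <= a] `|` [set s | b <= s])).
have clC1 : closed C1 by apply: closed_arc_image => //; exact: interval_closed.
have clC2 : closed C2.
  apply: closedU; first exact: edge_system_closed fG.
  by apply: closed_arc_image => //; apply: closedU; [exact: closed_le|exact: closed_ge].
have GC : G `\` A `<=` C1 `|` C2.
  move=> x [+ _]; rewrite GE => -[j _ [s Is <-]].
  have [->|/eqP ji] := eqVneq j i; last by right; left; exists j => //; exists s.
  have [sa|sa] := leP s a; first by right; right; exists s => //; split=> //; left.
  have [bs|bs] := leP b s; first by right; right; exists s => //; split=> //; right.
  by left; exists s => //; split=> //=; rewrite in_itv /= !ltW.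
have disj x : (G `\` A) x -> C1 x -> C2 x -> False.
  move=> [_ nAx] [s [Is]] /=; rewrite in_itv /= => asb sx.
  have send : s = a \/ s = b -> False by case=> E; apply: nAx; rewrite -sx E.
  case=> [[j /= ji [t It tx]]|[t [It tab] tx]].
    have := edge_system_meet fG Is It (etrans sx (esym tx)).
    case=> [[/esym//]|[s01 _]]; apply: send; move: Ia Ib; rewrite /unit_interval /=.
    by case: s01 => -> in asb *; [left|right]; lra.
  have st : s = t by apply: (injf i); rewrite ?inE // sx.
  by apply: send; move: tab; rewrite -st /= => -[?|?]; [left|right]; lra.
(* If [p] were in the segment, being an end of the edge it would be [f i a] or [f i b], hence in
   [A]. *)
have [GC1|GC2] := connected_closed_cover cGA clC1 clC2 GC disj.
  have [s [Is] /=] := GC1 _ (conj Gp nAp); rewrite in_itv /= => asb sp.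
  have [s01|s01] := unit_interval_end Is (fun s01 => p_vertex s01 sp);
    move: Ia Ib nAp; rewrite -sp /unit_interval /= => Ia Ib; apply.
    by have -> : s = a by lra.
  by have -> : s = b by lra.
apply: (disj (f i c)).
- by split=> //; rewrite GE; exists i => //; exists c.
- by exists c => //; split.
- by apply: GC2; split=> //; rewrite GE; exists i => //; exists c.
Qed.

Lemma edge_preimage_interval i : exists ab : R * R,
  (forall s, I01 s -> A (f i s) -> ab.1 <= s <= ab.2) /\
  (forall s, I01 s -> ab.1 < s < ab.2 -> A (f i s)).
Proof.
pose K := I01 `&` (f i @^-1` A).
have [K0|nK] := pselect (K !=set0); last first.
  (* For an edge missing [A], the reversed pair makes both conditions vacuous. *)
  exists (1, 0); split=> [s Is As|s _ /=]; first by case: nK; exists s.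
  by move=> ?; exfalso; lra.
have cK : compact K.
  apply: compact_closedI; first by rewrite unit_intervalE; exact: segment_compact.
  by have [cf _ _ _] := fG; have /continuous_closedP := cf i; exact.
have cid : {within K, continuous (id : R -> R)}.
  by apply: continuous_subspaceT => x; exact: cvg_id.
have [a] := compact_EVT_min K0 cK cid; rewrite inE => -[Ia Aa] amin.
have [b] := compact_EVT_max K0 cK cid; rewrite inE => -[Ib Ab] bmax.
exists (a, b); split=> s Is /=.
  by move=> As; rewrite amin ?bmax // inE.
by move=> asb; apply: (edge_preimage_convex Ia Ib) => //; lra.
Qed.

(** Cut each edge where its interval of parameters in [A] begins and ends. An open piece is
    connected and free of cut points, so it is either inside [A] or disjoint from it; closedness of
    [A] adds the ends. *)
Lemma edge_system_adapted : exists (J : finType) (g : J -> R -> X),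
  [/\ edge_system g G, forall j (s : R), 0 < s < 1 -> g j s <> p &
      forall j (s : R), 0 < s < 1 -> A (g j s) -> g j @` I01 `<=` A].
Proof.
have [cf injf GE disj] := fG.
have /choice[ab abP] := edge_preimage_interval.
pose F := p ::
  flatten [seq [:: f i 0; f i 1; f i (ab i).1; f i (ab i).2] | i <- enum I].
have inF i x : x \in [:: f i 0; f i 1; f i (ab i).1; f i (ab i).2] -> x \in F.
  move=> xi; rewrite inE; apply/orP; right; apply/flattenP.
  by eexists; [apply/mapP; exists i; [rewrite mem_enum|reflexivity]|exact: xi].
have [||||J [g [gS gF]]] := edge_system_subdivide (f := f) (F := F) => //.
- by move=> i; split; apply: (inF i); rewrite !inE eqxx ?orbT.
- move=> i j s t ij s01 t01 E; case: ij.
  exact: disj s01 (interior_unit_interval t01) E.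
rewrite -GE in gS; exists J, g; split=> //.
  by move=> j s s01 E; case/negP: (gF j s s01); rewrite E inE eqxx.
move=> j s s01 As.
(* A closed set covering the part of [G] off [A]; it meets [A] only in cut points. *)
pose C2 := \bigcup_i (f i @` (I01 `&` ([set s | s <= (ab i).1] `|` [set s | (ab i).2 <= s]))).
have clC2 : closed C2.
  apply: closed_bigcup; [exact: finite_finset|move=> i _]; apply: closed_arc_image => //.
  by apply: closedU; [exact: closed_le|exact: closed_ge].
pose O := g j @` `]0, 1[.
have [cg _ GE' _] := gS.
have cO : connected O by apply: connected_arc_image => //; exact: interval_is_interval.
have OF x : O x -> x \notin F by move=> [t /=]; rewrite in_itv => t01 <-; exact: gF.
have disjO x : O x -> A x -> C2 x -> False.
  move=> Ox Ax [i _ [t [It tab] tx]].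
  have [abi _] := abP i; have := abi t It; rewrite tx => /(_ Ax) abt.
  case/negP: (OF _ Ox); rewrite -tx; case: tab => /= tab.
    have -> : t = (ab i).1 by lra.
    by apply: (inF i); rewrite !inE eqxx ?orbT.
  have -> : t = (ab i).2 by lra.
  by apply: (inF i); rewrite !inE eqxx ?orbT.
have OAC : O `<=` A `|` C2.
  move=> x [t /=]; rewrite in_itv => t01 tx.
  have : G x by rewrite GE' -tx; exists j => //; exists t => //; exact: interior_unit_interval.
  rewrite GE => -[i _ [r Ir rx]]; have [_ abi] := abP i.
  have [ra|ra] := leP r (ab i).1; first by right; exists i => //; exists r => //; split=> //; left.
  have [br|br] := leP (ab i).2 r; first by right; exists i => //; exists r => //; split=> //; right.
  by left; rewrite -rx; apply: abi => //; rewrite ra.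
have Os : O (g j s) by exists s.
have OA : O `<=` A.
  have [//|OC2] := connected_closed_cover cO clA clC2 OAC disjO.
  by case: (disjO _ Os As (OC2 _ Os)).
have clgA : closed (g j @^-1` A) by have /continuous_closedP := cg j; exact.
move=> _ [t It <-]; apply: (closed_unit_interval_sub clgA) It => r r01.
by apply: OA; exists r.
Qed.
End AdaptedSubdivision.

(** * The vertex graph and its heights *)

Section Heights.
Variables (I : finType) (f : I -> R -> X) (G : set X).
Hypothesis fG : edge_system f G.

Definition vertices : seq X := [seq f i 0 | i <- enum I] ++ [seq f i 1 | i <- enum I].

Definition adjacent (x y : X) : Prop :=
  exists i, (x = f i 0 /\ y = f i 1) \/ (x = f i 1 /\ y = f i 0).

Lemma verticesP x : reflect (exists i, x = f i 0 \/ x = f i 1) (x \in vertices).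
Proof.
rewrite mem_cat; apply: (iffP orP).
  by case=> /mapP[i _ ->]; exists i; [left|right].
by case=> i [->|->]; [left|right]; apply/mapP; exists i; rewrite ?mem_enum.
Qed.

Lemma vertices_sub x : x \in vertices -> G x.
Proof.
by have [_ _ -> _] := fG; case/verticesP=> i [->|->]; exists i => //; [exists 0|exists 1].
Qed.

Let V := seq_sub vertices.
Let e : rel V := fun x y => `[< adjacent (val x) (val y) >].

Let e_sym : symmetric e.
Proof.
have adjC x y : adjacent x y -> adjacent y x.
  by move=> [i [[-> ->]|[-> ->]]]; exists i; [right|left].
by move=> x y; apply/asboolP/asboolP; exact: adjC.
Qed.

Let off (Q : set X) : {set V} := finset.finset (fun v => `[< ~ Q (val v) >]).

Let in_off Q v : (v \in off Q) = `[< ~ Q (val v) >].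
Proof. by rewrite finset.in_set. Qed.

(* A set of vertices closed under adjacency off Q yields a splitting of G \ Q into
   the edges that touch it and those that do not. *)
Let connected_off (Q : set X) : connected (G `\` Q) -> rel_connected e (off Q).
Proof.
move=> cGQ W WQ /finset.set0Pn[w wW] clW.
have [cf injf GE _] := fG.
pose touch := [set i | exists2 v : V, v \in W & (val v = f i 0 \/ val v = f i 1)].
pose C1 := \bigcup_(i in touch) (f i @` I01).
pose C2 := \bigcup_(i in ~` touch) (f i @` I01).
have clC1 : closed C1 by exact: edge_system_closed fG.
have clC2 : closed C2 by exact: edge_system_closed fG.
(* The two ends of an edge are adjacent, so once one of them is in [W] the other is too, provided it
   is off [Q]. *)
have touchW i (v : V) : touch i -> v \in off Q -> val v = f i 0 \/ val v = f i 1 ->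
    v \in W.
  move=> [u uW ui] vQ vi; have [->//|uv] := eqVneq v u.
  have vu : val v <> val u by move=> /val_inj E; rewrite E eqxx in uv.
  apply: clW uW vQ _; apply/asboolP; exists i.
  by case: ui vi => Eu [] Ev; rewrite Eu Ev in vu *; [case: vu|left|right|case: vu].
have GC : G `\` Q `<=` C1 `|` C2.
  move=> x [+ _]; rewrite GE => -[i _ xi].
  by have [ti|ti] := pselect (touch i); [left|right]; exists i.
have disj x : (G `\` Q) x -> C1 x -> C2 x -> False.
  move=> [_ nQx] [i ti [s Is sx]] [j tj [t It tx]].
  have [[E _]|[s01 t01]] := edge_system_meet fG Is It (etrans sx (esym tx)).
    by apply: tj; rewrite -E.
  have xi : x = f i 0 \/ x = f i 1 by rewrite -sx; case: s01 => ->; [left|right].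
  have xj : x = f j 0 \/ x = f j 1 by rewrite -tx; case: t01 => ->; [left|right].
  have xV : x \in vertices by apply/verticesP; exists i.
  apply: tj; exists (SeqSub xV) => //; apply: (touchW i (SeqSub xV) ti _ xi).
  by rewrite in_off; apply/asboolP.
have offG (v : V) : v \in off Q -> (G `\` Q) (val v).
  by rewrite in_off => /asboolP nQ; split=> //; exact/vertices_sub/ssvalP.
have GC1 : G `\` Q `<=` C1.
  have [//|GC2] := connected_closed_cover cGQ clC1 clC2 GC disj.
  have wG := offG _ (fintype.subsetP WQ _ wW).
  exfalso; apply: (disj _ wG _ (GC2 _ wG)).
  have /verticesP[i wi] := ssvalP w; exists i; first by exists w.
  by case: wi => E; [exists 0|exists 1].
apply/eqP; rewrite finset.eqEsubset WQ; apply/fintype.subsetP => v vQ.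
have [i ti [s Is sv]] := GC1 _ (offG _ vQ).
apply: touchW ti vQ _.
have /verticesP[j vj] : f i s \in vertices by rewrite sv; exact: ssvalP.
have : s = 0 \/ s = 1.
  by case: vj => /(edge_system_meet fG Is) [] // [] // _ ->; [left|right].
by rewrite -sv => -[->|->]; [left|right].
Qed.

Variables (A : set X) (p : X).
Hypotheses (cG : connected G) (cG1 : forall x, G x -> connected (G `\ x)).
Hypotheses (cGA : connected (G `\` A)) (nAp : ~ A p) (Vp : p \in vertices).
Hypothesis VA : exists2 x, x \in vertices & A x.

Lemma exists_height : exists r : X -> nat, [/\
  forall x, x \in vertices -> (r x = 0)%N <-> A x,
  forall x, x \in vertices -> ~ A x -> exists2 y, adjacent x y & (r y < r x)%N,
  forall x, x \in vertices -> ~ A x -> x <> p -> exists2 y, adjacent x y & (r x < r y)%N,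
  forall x, x \in vertices -> x <> p -> (r x < r p)%N
  & forall i, r (f i 0) = r (f i 1) -> A (f i 0)].
Proof.
pose S : {set V} := ~: off A.
have SE v : v \in S = `[< A (val v) >].
  by rewrite finset.in_setC in_off -asbool_neg notK.
pose q : V := SeqSub Vp.
have [|||||r [r0 rlow rhigh rp rinj]] := @exists_st_order V e e_sym S q.
- have -> : [set: V]%SET = off set0.
    by apply/finset.setP => v; rewrite finset.in_setT in_off; apply/esym/asboolP.
  by apply: connected_off; rewrite setD0.
- move=> v; have -> : (~: [set v])%SET = off [set val v].
    apply/finset.setP => u; rewrite finset.in_setC finset.in_set1 in_off.
    apply/idP/asboolP => [/eqP uv E|uv]; first exact/uv/val_inj.
    by apply/eqP => E; apply: uv; rewrite E.
  by apply: connected_off; apply: cG1; exact/vertices_sub/ssvalP.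
- by rewrite finset.setCK; exact: connected_off.
- by rewrite SE; apply/asboolP.
- have [x xV Ax] := VA; apply/finset.set0Pn; exists (SeqSub xV); rewrite SE.
  exact/asboolP.
(* Heights matter at vertices only; other points get the filler value 0. *)
pose rX x : nat := if insub x is Some v then r v else 0%N.
have rXE (v : V) : rX (val v) = r v by rewrite /rX valK.
have VE x : x \in vertices -> exists v : V, val v = x.
  by move=> xV; exists (SeqSub xV).
have nSE v : (v \notin S) = `[< ~ A (val v) >] by rewrite SE asbool_neg.
exists rX; split.
- move=> _ /VE[v <-]; rewrite rXE; split=> [/eqP|Av].
    by rewrite r0 SE => /asboolP.
  by apply/eqP; rewrite r0 SE; apply/asboolP.
- move=> _ /VE[v <-] /asboolP; rewrite -nSE => /rlow[u /asboolP vu ru].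
  by exists (val u); rewrite ?rXE.
- move=> _ /VE[v <-] /asboolP; rewrite -nSE => nS vp.
  have [|u /asboolP vu ru] := rhigh v nS; first by apply/eqP => E; apply: vp; rewrite E.
  by exists (val u); rewrite ?rXE.
- move=> _ /VE[v <-] vp; rewrite rXE -[p]/(val q) rXE; apply: rp.
  by apply/eqP => E; apply: vp; rewrite E.
- move=> i; have V0 : f i 0 \in vertices by apply/verticesP; exists i; left.
  have V1 : f i 1 \in vertices by apply/verticesP; exists i; right.
  rewrite -[f i 0]/(val (SeqSub V0 : V)) -[f i 1]/(val (SeqSub V1 : V)) !rXE.
  case/rinj => [|E]; first by rewrite SE => /asboolP.
  have [_ injf _ _] := fG; have : f i 0 = f i 1 by exact: (congr1 val E).
  have I0 : (0 : R) \in I01 by rewrite inE.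
  have I1 : (1 : R) \in I01 by rewrite inE.
  by move/(injf i _ _ I0 I1)/eqP; rewrite eq_sym oner_eq0.
Qed.

End Heights.

(** * The sweep by sublevel sets *)

Section Sweep.
Variables (I : finType) (f : I -> R -> X) (G A : set X) (p : X) (r : X -> nat).
Hypothesis fG : edge_system f G.
Hypotheses (AG : A `<=` G) (A0 : A !=set0) (cA : connected A).
Hypotheses (nAp : ~ A p) (Vp : p \in vertices f).

(** Edges are oriented so that heights never drop along them. By [edge_cases] an edge that does not
    rise lies inside [A], and a rising one can meet [A] only at its lower end. *)
Let rising i := (r (f i 0) < r (f i 1))%N.

Hypothesis rA : forall x, x \in vertices f -> (r x = 0)%N <-> A x.
Hypothesis edge_cases : forall i,
  (r (f i 1) = 0%N /\ r (f i 0) = 0%N /\ f i @` I01 `<=` A) \/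
  (rising i /\ forall s, 0 < s <= 1 -> ~ A (f i s)).
Hypothesis low : forall x, x \in vertices f -> ~ A x -> exists2 i, x = f i 1 & rising i.
Hypothesis high : forall x, x \in vertices f -> ~ A x -> x <> p ->
  exists2 i, x = f i 0 & rising i.
Hypothesis rp : forall x, x \in vertices f -> x <> p -> (r x < r p)%N.

Let N : R := (r p)%:R.
Let lin i (s : R) : R := (r (f i 0))%:R + s * ((r (f i 1))%:R - (r (f i 0))%:R).
Let level (x : X) : R := xget 0 [set y | exists i s, [/\ I01 s, f i s = x & y = lin i s]].

Let V0 i : f i 0 \in vertices f. Proof. by apply/verticesP; exists i; left. Qed.
Let V1 i : f i 1 \in vertices f. Proof. by apply/verticesP; exists i; right. Qed.

Let GP x : G x -> exists i s, I01 s /\ x = f i s.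
Proof. by have [_ _ -> _] := fG; move=> [i _ [s Is <-]]; exists i, s. Qed.

Let Gf i s : I01 s -> G (f i s).
Proof. by have [_ _ -> _] := fG; exists i => //; exists s. Qed.

(** The choice made in [level] does not matter: two parametrisations of a point agree or both give
    an end of an edge, where [lin] returns the height of the vertex. *)
Let levelE i s : I01 s -> level (f i s) = lin i s.
Proof.
move=> Is; rewrite /level; case: xgetP => [y _ [j [t [It tE ->]]]|]; last first.
  by move=> /(_ (lin i s))[]; exists i, s.
have [[-> ->]//|[t01 s01]] := edge_system_meet fG It Is tE.
have end_lin k u : u = 0 \/ u = 1 -> lin k u = (r (f k u))%:R.
  by rewrite /lin => -[->|->]; rewrite ?mul0r ?addr0 ?mul1r // addrC subrK.
by rewrite !end_lin // tE.
Qed.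

Let level0 i : level (f i 0) = (r (f i 0))%:R.
Proof. by rewrite levelE // /lin mul0r addr0. Qed.

Let level1 i : level (f i 1) = (r (f i 1))%:R.
Proof. by rewrite levelE // /lin mul1r addrC subrK. Qed.

Let level_vertex x : x \in vertices f -> level x = (r x)%:R.
Proof. by case/verticesP=> i [->|->]. Qed.

Let risingE i : rising i -> (r (f i 0))%:R < (r (f i 1))%:R :> R.
Proof. by rewrite ltr_nat. Qed.

Let le_lin i s t : rising i -> s <= t -> lin i s <= lin i t.
Proof. by move=> /risingE ri st; rewrite /lin; nra. Qed.

Let level_A x : A x -> level x = 0.
Proof.
move=> Ax; have [i [s [Is xE]]] := GP (AG Ax).
have [[r1 [r0 _]]|[_ nA]] := edge_cases i.
  by rewrite xE levelE // /lin r0 r1 subrr mulr0 addr0.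
have s0 : s = 0.
  apply: contrapT => /eqP s0; apply: (nA s); last by rewrite -xE.
  by case/andP: Is => s0' ->; rewrite lt_neqAle eq_sym s0 s0'.
by rewrite xE s0 level0; have -> : r (f i 0) = 0%N by apply/rA; rewrite // -s0 -xE.
Qed.

(** There is no local minimum of the level off [A]: inside an edge that edge leads down, and at a
    vertex [low] provides one. *)
Let descending x : G x -> ~ A x ->
  exists i s, [/\ rising i, 0 < s <= 1 & x = f i s].
Proof.
move=> Gx nAx; have [i [s [Is xE]]] := GP Gx.
have [s01|/(unit_interval_end Is) s01] := pselect (0 < s < 1).
  exists i, s; split=> //; last by case/andP: s01 => -> /ltW.
  have [[_ [_ fA]]|[]//] := edge_cases i.
  by case: nAx; apply: fA; exists s.
have Vx : x \in vertices f by rewrite xE; case: s01 => ->.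
have [j xj rj] := low Vx nAx; exists j, 1; split=> //; by rewrite ltr01 lexx.
Qed.

Let ascending x : G x -> ~ A x -> x <> p ->
  exists i s, [/\ rising i, 0 <= s < 1 & x = f i s].
Proof.
move=> Gx nAx xp; have [i [s [Is xE]]] := GP Gx.
have [s01|/(unit_interval_end Is) s01] := pselect (0 < s < 1).
  exists i, s; split=> //; last by case/andP: s01 => /ltW ->.
  have [[_ [_ fA]]|[]//] := edge_cases i.
  by case: nAx; apply: fA; exists s.
have Vx : x \in vertices f by rewrite xE; case: s01 => ->.
have [j xj rj] := high Vx nAx xp; exists j, 0; split=> //; by rewrite ltr01 lexx.
Qed.

Let level_gt0 x : G x -> ~ A x -> 0 < level x.
Proof.
move=> Gx /(descending Gx)[i [s [ri s01 ->]]]; rewrite levelE; last first.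
  by rewrite /unit_interval /=; lra.
by have := risingE ri; have : 0 <= (r (f i 0))%:R :> R by []; rewrite /lin => *; nra.
Qed.

Let level_ge0 x : G x -> 0 <= level x.
Proof.
move=> Gx; have [/level_A ->//|nAx] := pselect (A x).
exact/ltW/level_gt0.
Qed.

Let level_p : level p = N. Proof. exact: level_vertex. Qed.

Let N_gt0 : 0 < N.
Proof. by rewrite -level_p; apply: level_gt0 => //; exact: vertices_sub Vp. Qed.

Let level_ltN x : G x -> x <> p -> level x < N.
Proof.
move=> Gx xp; have [/level_A ->//|nAx] := pselect (A x).
have [i [s [ri s01 ->]]] := ascending Gx nAx xp.
rewrite levelE; last by rewrite /unit_interval /=; lra.
have r1N : (r (f i 1))%:R <= N.
  have [->//|/eqP f1p] := eqVneq (f i 1) p.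
  by rewrite ler_nat ltnW // rp.
by have := risingE ri; rewrite /lin => *; nra.
Qed.

Let level_leN x : G x -> level x <= N.
Proof.
move=> Gx; have [->|/eqP xp] := eqVneq x p; first by rewrite level_p.
exact/ltW/level_ltN.
Qed.

(** Follow a rising edge down to its lower end. The level there is an integer strictly below
    [level x], so the bound [n] drops by one. *)
Let descend n x : G x -> level x <= n%:R ->
  exists C, [/\ connected C, C x, C `&` A !=set0 &
    C `<=` [set y | G y /\ level y <= level x]].
Proof.
elim: n x => [|n IHn] x Gx lex; have [Ax|nAx] := pselect (A x);
  try by exists [set x]; split=> //; [exact: connected1|exists x|move=> _ ->].
  by have := level_gt0 Gx nAx; rewrite ltNge lex.
have [i [s [ri s01 xE]]] := descending Gx nAx.
have Is : I01 s by rewrite /unit_interval /=; lra.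
have lt0 : level (f i 0) < level x.
  by rewrite level0 xE levelE // /lin; have := risingE ri; nra.
have [||C [cC C0 CA Clow]] := IHn (f i 0).
- exact: Gf.
- by move: (lt_le_trans lt0 lex); rewrite level0 ltr_nat ler_nat.
exists (f i @` `[0, s] `|` C); split.
- apply: connectedU => //.
    by exists (f i 0); split=> //; exists 0 => //=; rewrite in_itv /= lexx; lra.
  apply: connected_arc_image; [by case: fG|exact: interval_is_interval].
- by left; exists s => //=; rewrite in_itv /= lexx andbT; lra.
- by case: CA => a [Ca Aa]; exists a; split=> //; right.
- move=> y [[t /=]|/Clow[Gy ly]]; last by split=> //; exact: le_trans (ltW lt0).
  rewrite in_itv /= => ts <-.
  have It : I01 t by move: Is; rewrite /unit_interval /=; lra.
  by split; [exact: Gf|rewrite xE !levelE // le_lin //; case/andP: ts].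
Qed.

(** The upward counterpart, by induction on a bound for the remaining climb to [p]; upper ends stay
    off [A] because their level is positive. *)
Let ascend n x : G x -> ~ A x -> N <= level x + n%:R ->
  exists C, [/\ connected C, C x, C p & C `<=` [set y | G y /\ level x <= level y]].
Proof.
elim: n x => [|n IHn] x Gx nAx lex; have [xp|/eqP xp] := eqVneq x p;
  try by exists [set x]; split=> //; [exact: connected1|move=> _ ->].
  by have := level_ltN Gx xp; rewrite ltNge -(addr0 (level x)) lex.
have [i [s [ri s01 xE]]] := ascending Gx nAx xp.
have Is : I01 s by rewrite /unit_interval /=; lra.
have lt1 : level x < level (f i 1).
  by rewrite level1 xE levelE // /lin; have := risingE ri; nra.
have [|||C [cC C1 Cp Chigh]] := IHn (f i 1).
- exact: Gf.
- by move=> /level_A E; have := level_ge0 Gx; rewrite leNgt -E lt1.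
- have : N < level (f i 1) + n.+1%:R by apply: le_lt_trans lex _; rewrite ltrD2r.
  by rewrite level1 -!natrD ltr_nat ler_nat addnS.
exists (f i @` `[s, 1] `|` C); split=> //.
- apply: connectedU => //.
    by exists (f i 1); split=> //; exists 1 => //=; rewrite in_itv /= lexx; lra.
  apply: connected_arc_image; [by case: fG|exact: interval_is_interval].
- by left; exists s => //=; rewrite in_itv /= lexx; lra.
- by right.
- move=> y [[t /=]|/Chigh[Gy ly]]; last by split=> //; exact: le_trans (ltW lt1) _.
  rewrite in_itv /= => ts <-.
  have It : I01 t by move: Is; rewrite /unit_interval /=; lra.
  by split; [exact: Gf|rewrite xE !levelE // le_lin //; case/andP: ts].
Qed.

Let alpha (t : R) : set X := [set x | G x /\ level x <= t * N].

Let alpha_closed t : closed (alpha t).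
Proof.
have [cf _ GE _] := fG.
have -> : alpha t = \bigcup_i (f i @` (I01 `&` [set s | lin i s <= t * N])).
  apply/seteqP; split=> [x [Gx lx]|x [i _ [s [Is sl] <-]]].
    have [i [s [Is xE]]] := GP Gx; exists i => //; exists s => //; split=> //=.
    by rewrite -levelE // -xE.
  by split; [exact: Gf|rewrite levelE].
apply: closed_bigcup; [exact: finite_finset|move=> i _]; apply: closed_arc_image => //.
have /continuous_closedP H : continuous (lin i) by exact: continuous_affine.
suff : closed (lin i @^-1` [set y | y <= t * N]) by [].
by apply: H; exact: closed_le.
Qed.

Let A_alpha t : 0 <= t -> A `<=` alpha t.
Proof.
move=> t0 x Ax; split; first exact: AG.
by rewrite level_A // mulr_ge0 // ltW.
Qed.

(** Descending paths make the sublevel set a star around [A], ascending paths make its complement a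
    star around [p]. At [t = 1] the complement is empty. *)
Let alpha_NC t : I01 t -> NCstar G (alpha t).
Proof.
move=> /andP[t0 t1]; split.
  split; first by move=> x [].
  split; first by have [a Aa] := A0; exists a; exact: A_alpha Aa.
  split; first exact: alpha_closed.
  apply: (connected_star cA (A_alpha t0) A0) => x [Gx lx].
  have [|C [cC Cx CA Clow]] := @descend (r p) x Gx; first exact: level_leN.
  exists C; split=> // y /Clow[Gy ly]; split=> //; exact: le_trans lx.
have [t1'|t1'] := ltP t 1; last first.
  have -> : G `\` alpha t = set0; last exact: connected0.
  apply/seteqP; split=> // x [Gx]; case; split=> //.
  by apply: le_trans (level_leN Gx) _; rewrite ler_peMl // ltW.
have above x : G x -> ~ (level x <= t * N) -> (G `\` alpha t) x.
  by move=> Gx lx; split=> // -[].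
have Gp : G p := vertices_sub fG Vp.
apply: (connected_star (@connected1 _ p)) => [_ ->| |x [Gx nx]].
- by apply: above => //; rewrite level_p; apply/negP; rewrite -ltNge gtr_pMl.
- by exists p.
have lx : t * N < level x by rewrite ltNge; apply/negP => lx; apply: nx.
have nAx : ~ A x by move=> /(A_alpha t0).
have [|C [cC Cx Cp Chigh]] := @ascend (r p) x Gx nAx.
  by rewrite lerDr level_ge0.
exists C; split=> //; first by exists p.
move=> y /Chigh[Gy ly]; apply: above => //; apply/negP; rewrite -ltNge.
exact: lt_le_trans ly.
Qed.

(** A point with level between [a] and [b] slides down a rising edge to level [a]. The edge reaches
    that far because [d] is at most the distance from [tau] to any other lower-end height, so no
    such height lies strictly between [a] and [b]. *)
Let level_approx (tau eps : R) : 0 < eps -> exists2 d : R, 0 < d &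
  forall a b x, 0 <= a -> a <= b -> b - a < d -> a = tau \/ b = tau ->
    G x -> level x <= b -> exists y, [/\ G y, level y <= a & mdist x y < eps].
Proof.
move=> e0; have [cf _ _ _] := fG.
pose P i (d : R) := ((r (f i 0))%:R <> tau -> d <= `|(r (f i 0))%:R - tau|) /\
  (rising i -> forall s t, I01 s -> I01 t -> `|lin i s - lin i t| < d ->
     mdist (f i s) (f i t) < eps).
have [||d d0 dP] := @finite_uniform_pos R I P.
- move=> i; have [eta eta0 etaP] := arc_uniform_continuity (cf i) e0.
  pose w : R := (r (f i 1))%:R - (r (f i 0))%:R.
  pose g : R := `|(r (f i 0))%:R - tau|.
  (* The level has slope [w] along the edge, so a level change below [eta * w] is a parameter change
     below [eta]. *)
  pose d1 := if rising i then eta * w else 1.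
  pose d2 := if g == 0 then 1 else g.
  have d10 : 0 < d1.
    by rewrite /d1; case: ifP => // /risingE ri; rewrite mulr_gt0 // subr_gt0.
  have d20 : 0 < d2 by rewrite /d2; case: ifP => // g0; rewrite lt_neqAle eq_sym g0 normr_ge0.
  exists (Num.min d1 d2); first by rewrite lt_min d10.
  split=> [/eqP ne|ri s t Is It].
    by rewrite ge_min /d2 /g normr_eq0 subr_eq0 (negbTE ne) lexx orbT.
  have w0 : 0 < w by rewrite subr_gt0 risingE.
  rewrite lt_min /d1 ri => /andP[+ _]; rewrite /lin -/w.
  have -> : (r (f i 0))%:R + s * w - ((r (f i 0))%:R + t * w) = (s - t) * w by lra.
  by rewrite normrM (gtr0_norm w0) ltr_pM2r //; exact: etaP.
- move=> i d d' /andP[d'0 d'd] [P1 P2]; split=> [/P1|ri s t Is It lt].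
    exact: le_trans.
  by apply: P2 => //; exact: lt_le_trans d'd.
exists d => // a b x a0 ab bad tau_ab Gx lx.
have [lxa|alx] := leP (level x) a; first by exists x; split=> //; rewrite mdistxx.
have nAx : ~ A x by move=> /level_A E; rewrite E in alx; lra.
have [i [s [ri s01 xE]]] := descending Gx nAx.
have Is : I01 s by rewrite /unit_interval /=; lra.
have r01 := risingE ri; have [P1 /(_ ri) P2] := dP i.
rewrite xE levelE // in lx alx.
have lt0 : (r (f i 0))%:R < b by move: lx; rewrite /lin; nra.
have r0a : (r (f i 0))%:R <= a.
  rewrite leNgt; apply/negP => ar0.
  have ne : (r (f i 0))%:R <> tau by case: tau_ab => <-; lra.
  have := P1 ne; case: tau_ab => E.
    by rewrite ger0_norm -E; lra.
  by rewrite ler0_norm -E; lra.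
pose w : R := (r (f i 1))%:R - (r (f i 0))%:R; have w0 : 0 < w by rewrite subr_gt0.
(* The parameter at which this edge has level [a]. *)
pose t := (a - (r (f i 0))%:R) / w.
have lt : lin i t = a by rewrite /lin -/w /t divfK ?gt_eqF // addrC subrK.
have It : I01 t.
  apply/andP; split; first by rewrite divr_ge0 ?subr_ge0 // ltW.
  by rewrite ler_pdivrMr // mul1r lerD2r; move: alx; rewrite /lin; nra.
exists (f i t); split; [exact: Gf|by rewrite levelE // lt|].
by rewrite xE; apply: P2 => //; rewrite lt ger0_norm; lra.
Qed.

Let alpha_continuous : hausdorff_continuous01 alpha.
Proof.
move=> t It eps e0; have [d d0 dP] := level_approx (t * N) e0.
(* Time [t] corresponds to level [t * N]. The sets increase with time, so only points of the later
   set need approximation, by [level_approx]. *)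
exists (d / N); first by rewrite divr_gt0.
move=> s Is; rewrite ltr_pdivlMr // => std.
have mono u v : u <= v -> alpha u `<=` alpha v.
  move=> uv x [Gx lx]; split=> //; apply: le_trans lx _.
  by rewrite ler_pM2r.
have approx u v x : I01 u -> u <= v -> (v - u) * N < d -> u = t \/ v = t ->
    alpha v x -> exists2 y, alpha u y & mdist x y < eps.
  move=> /andP[u0 _] uv uvd ut [Gx lx].
  have [||||y [Gy ly xy]] := dP (u * N) (v * N) x _ _ _ _ Gx lx.
  - by rewrite mulr_ge0 // ltW.
  - by rewrite ler_pM2r.
  - by rewrite -mulrBl.
  - by case: ut => ->; [left|right].
  by exists y.
have [st|/ltW ts] := leP s t.
  rewrite ler0_norm ?subr_le0 // opprB in std.
  split=> [x /(mono _ _ st) ax|y ay]; first by exists x; rewrite ?mdistxx.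
  by have [x ax xy] := approx s t y Is st std (or_intror erefl) ay; exists x; rewrite // metric_sym.
rewrite ger0_norm ?subr_ge0 // in std.
split=> [x ax|y /(mono _ _ ts) ay]; last by exists y; rewrite ?mdistxx.
exact: (approx t s x It ts std (or_introl erefl) ax).
Qed.

Lemma exists_sweep : exists alpha : R -> set X,
  (forall t, I01 t -> NCstar G (alpha t)) /\
  hausdorff_continuous01 alpha /\
  alpha 0 = A /\ alpha 1 = G /\
  (forall t, I01 t -> alpha t <> G -> ~ alpha t p).
Proof.
have alpha1 : alpha 1 = G.
  apply/seteqP; split=> [x []//|x Gx]; split=> //.
  by rewrite mul1r; exact: level_leN.
exists alpha; do !split=> //.
- apply/seteqP; split=> [x [Gx]|]; last exact: A_alpha.
  rewrite mul0r => lx; apply: contrapT => nAx.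
  by have := level_gt0 Gx nAx; rewrite ltNge lx.
- move=> t /andP[t0 t1] tG [_]; rewrite level_p.
  have [E|t1'] := eqVneq t 1; first by move: tG; rewrite E alpha1.
  by apply/negP; rewrite -ltNge gtr_pMl // lt_neqAle t1'.
Qed.
End Sweep.

(** * Orienting the edges and assembling the proof *)

Lemma edge_system_flip (I : finType) (f : I -> R -> X) (G : set X) (b : pred I) :
  edge_system f G -> edge_system (fun i s => f i (if b i then 1 - s else s)) G.
Proof.
move=> [cf injf GE disj].
have flipI i s : I01 s -> I01 (if b i then 1 - s else s).
  by rewrite /unit_interval /=; case: (b i) => *; lra.
split.
- move=> i; case: (b i); last exact: cf.
  have -> : (fun s => f i (1 - s)) = (fun s : R => f i (1 + s * -1)).
    by apply/funext => s; rewrite mulrN1.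
  exact: continuous_comp_affine.
- move=> i s t; rewrite !inE => Is It E.
  have : (if b i then 1 - s else s) = (if b i then 1 - t else t).
    by apply: (injf i) E; rewrite inE; exact: flipI.
  by case: (b i) => [/subrI|].
- rewrite GE; apply/seteqP; split=> _ [i _ [s Is <-]]; exists i => //.
    exists (if b i then 1 - s else s); first exact: flipI.
    by case: (b i) => //; rewrite subKr.
  by exists (if b i then 1 - s else s) => //; exact: flipI.
- move=> i j s t s01 It; apply: disj; last exact: flipI.
  by case: (b i) => //; lra.
Qed.

Lemma not_interior_vertex (I : finType) (f : I -> R -> X) (G : set X) x :
  edge_system f G -> G x -> (forall i (s : R), 0 < s < 1 -> f i s <> x) ->
  x \in vertices f.
Proof.
move=> [_ _ -> _] [i _ [s Is sx]] nx; apply/verticesP; exists i; rewrite -sx.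
by have [->|->] := unit_interval_end Is (fun s01 => nx i s s01 sx); [left|right].
Qed.

End Arcs.

Theorem theorem4 (R : realType) (X : metricType R) (G : set X) (p : X) (A : set X) :
  tangle G -> G p -> NCstar G A -> ~ A p ->
  exists alpha : R -> set X,
    (forall t, unit_interval R t -> NCstar G (alpha t)) /\
    hausdorff_continuous01 alpha /\
    alpha 0 = A /\ alpha 1 = G /\
    (forall t, unit_interval R t -> alpha t <> G -> ~ alpha t p).
Proof.
move=> [graphG cut] Gp [[AG [A0 [clA cA]]] cGA] nAp.
have cG : connected G by case: graphG => -[_ []].
have [I0 [f0 [f0G f0p]]] := finite_graph_edges p graphG.
have [I [f [fG fp fA]]] := edge_system_adapted f0G Gp nAp f0p clA cGA.
have Vp : p \in vertices f := not_interior_vertex fG Gp fp.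
have I0' := unit_interval0 R; have I1' := unit_interval1 R.
(* A point of [A] is a vertex, or interior to an edge that then lies in [A] with both its ends. *)
have VA : exists2 x, x \in vertices f & A x.
  have [x Ax] := A0.
  have [[i [s s01 sx]]|nx] := pselect (exists i, exists2 s : R, 0 < s < 1 & f i s = x).
    exists (f i 0); first by apply/verticesP; exists i; left.
    by apply: (fA i s s01); [rewrite sx|exists 0].
  exists x => //; apply: not_interior_vertex fG (AG _ Ax) _ => i s s01 sx.
  by apply: nx; exists i, s.
have [r [rA low high rp req]] := exists_height fG cG cut cGA nAp Vp VA.
(* Reverse exactly the edges along which the height drops. *)
pose b i := (r (f i 1%R) < r (f i 0%R))%N.
pose g i (s : R) := f i (if b i then 1 - s else s).
have gG : edge_system g G := edge_system_flip b fG.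
have g0 i : g i 0 = if b i then f i 1 else f i 0 by rewrite /g; case: (b i); rewrite ?subr0.
have g1 i : g i 1 = if b i then f i 0 else f i 1 by rewrite /g; case: (b i); rewrite ?subrr.
have f0V i : f i 0 \in vertices f by apply/verticesP; exists i; left.
have f1V i : f i 1 \in vertices f by apply/verticesP; exists i; right.
have Vg x : (x \in vertices g) = (x \in vertices f).
  by apply/verticesP/verticesP => -[i]; rewrite ?g0 ?g1 => xi; exists i;
    rewrite ?g0 ?g1; move: xi; case: (b i) => -[]; auto.
have gle i : (r (g i 0%R) <= r (g i 1%R))%N.
  by rewrite g0 g1; case: ifPn; rewrite /b -?leqNgt // => /ltnW.
have gA i s : 0 < s < 1 -> A (g i s) -> g i @` unit_interval R `<=` A.
  move=> s01 As _ [t It <-].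
  apply: (fA i (if b i then 1 - s else s)) => //; first by case: (b i) => //; lra.
  exists (if b i then 1 - t else t) => //.
  by move: It; rewrite /unit_interval /=; case: (b i) => // *; lra.
apply: (@exists_sweep _ _ I g G A p r) => //.
- by rewrite Vg.
- by move=> x; rewrite Vg; exact: rA.
(* Equal heights put both ends in [A], and convexity of the preimage of [A] fills the edge. A rising
   edge meeting [A] above its lower end would have its upper end in [A], at height 0. *)
- move=> i; have := gle i; rewrite leq_eqVlt => /orP[/eqP E|ri].
    have A01 : A (g i 0) /\ A (g i 1).
      have E' : r (f i 0) = r (f i 1) by move: E; rewrite g0 g1; case: (b i).
      have Af0 := req i E'.
      have Af1 : A (f i 1) by apply/rA => //; rewrite -E'; apply/rA.
      by rewrite g0 g1; case: (b i).
    left; split; first by apply/rA; [rewrite -Vg; apply/verticesP; exists i; right|case: A01].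
    split; first by apply/rA; [rewrite -Vg; apply/verticesP; exists i; left|case: A01].
    move=> _ [s Is <-]; case: A01 => A0' A1'.
    apply: (edge_preimage_convex gG Gp nAp _ cGA I0' I1' _ A0' A1') => //.
    move=> j t t01; apply: fp; by case: (b j) => //; lra.
  right; split=> // s /andP[s0 s1] As.
  have A1 : A (g i 1).
    move: s1; rewrite le_eqVlt => /orP[/eqP <-//|s1].
    by apply: (gA i s); rewrite ?s0 //; exists 1.
  suff E : r (g i 1) = 0%N by move: ri; rewrite E ltn0.
  by apply/rA => //; rewrite -Vg; apply/verticesP; exists i; right.
- move=> x; rewrite Vg => xV nAx; have [y [i xy] ryx] := low x xV nAx.
  have nxy : (r x < r y)%N = false by rewrite ltnNge ltnW.
  by exists i; rewrite ?g0 g1 /b; case: xy => -[<- <-]; rewrite ?ryx ?nxy.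
- move=> x; rewrite Vg => xV nAx xp; have [y [i xy] rxy] := high x xV nAx xp.
  have nyx : (r y < r x)%N = false by rewrite ltnNge ltnW.
  by exists i; rewrite g0 ?g1 /b; case: xy => -[<- <-]; rewrite ?rxy ?nyx.
- by move=> x; rewrite Vg; exact: rp.
Qed.
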